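(* Let $c = 1-\frac{\log(e\log 2)}{\log 2}=0.086\ldots$. For Lebesgue-almost every $\alpha>0$ there is a constant $C=C(\alpha)>0$ such that $\delta_{\min}^{(\alpha)}(N)\ge C\,\frac{(\log N)^c}{N}$ for infinitely many integers $N$.
   Context: For irrational $\alpha>0$, the numbers $\alpha m^2+n^2$ with integers $m,n\ge 1$ are pairwise distinct; list them in increasing order as $0<\lambda_1<\lambda_2<\cdots$. For $N\ge 2$ define the minimal gap $\delta_{\min}^{(\alpha)}(N)=\min\{\lambda_{i+1}-\lambda_i : 1\le i<N\}$. *)

(* Defs.v *)
From HB Require Import structures.
From mathcomp Require Import all_boot all_order all_algebra.
From mathcomp Require Import all_classical all_reals all_analysis.
Set Implicit Arguments. Unset Strict Implicit. Unset Printing Implicit Defensive.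
Import Order.TTheory GRing.Theory Num.Theory.
Local Open Scope ring_scope.

(* l : nat -> R is the increasing enumeration 0 < lambda_1 < lambda_2 < ...
   of the set { a m^2 + n^2 : m, n >= 1 }, with the shift l i = lambda_(i+1). *)
Definition is_lambda_seq {R : realType} (a : R) (l : nat -> R) : Prop :=
  (forall i : nat, l i < l i.+1) /\
  (forall x : R, (exists i : nat, l i = x) <->
     exists m n : nat, (1 <= m)%N /\ (1 <= n)%N /\ x = a * (m%:R) ^+ 2 + (n%:R) ^+ 2).

(* delta_min(N) = min_{1 <= i < N} (lambda_{i+1} - lambda_i), meaningful for N >= 2
   (the initial value l 1 - l 0 = lambda_2 - lambda_1 is itself one of the gaps). *)
Definition delta_min {R : realType} (l : nat -> R) (N : nat) : R :=
  \big[Order.min/(l 1%N - l 0%N)]_(j < N.-1) (l j.+1 - l j).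

Definition c_exp {R : realType} : R := 1 - ln (expR 1 * ln 2) / ln 2.

(* Main.v *)
Require Import Defs.
From HB Require Import structures.
From mathcomp Require Import all_boot all_order all_algebra.
From mathcomp Require Import all_classical all_reals all_analysis.
From mathcomp Require Import ring lra zify.
Import Order.TTheory GRing.Theory Num.Theory.
Local Open Scope ring_scope.

(* A gap below 1 among the a m^2 + n^2 with m <= X/2 equals |a u - v|, where
   u = |m - m'| (m + m') is an entry of the X by X multiplication table. Summing the
   lengths of the intervals |a - v/u| < d/u over these u and over v = O(u), the slopes
   a <= J having such a gap below d form a set of measure O(J d #table). Erdos' bound
   #table <= C X^2 (log X)^(-c) along a sequence of scales X then makes the measure O(eps)
   for d = eps (log X)^c X^(-2), so almost no slope is bad for every eps at all large scales.

   For the table put z = 1/log 2. An entry n = ab has either Omega(n) >= z log log X or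
   Omega(a) + Omega(b) <= z log log X; weighting by z^Omega and (z/2)^Omega, both cases
   contribute X^2 (log X)^(-c). Only logarithmic means of x^Omega(n) are estimated:
   averaging over dyadic scales recovers plain means at infinitely many of them. This
   avoids every estimate on primes, as Rankin's shift n^(-1-1/K) reduces the logarithmic
   mean to the elementary bound zeta(1 + 1/K) <= 1 + K. *)

(** * Prime factors counted with multiplicity *)

Definition Omega (n : nat) : nat := (\sum_(p < n.+1) logn p n)%N.

Lemma Omega_widen (n N : nat) : (n < N)%N -> Omega n = (\sum_(p < N) logn p n)%N.
Proof.
move=> nN; rewrite /Omega -!(big_mkord xpredT (fun p => logn p n)).
rewrite [RHS](big_cat_nat (leq0n n.+1))//= -[LHS]addn0; congr (_ + _)%N.
by rewrite big_nat_cond big1// => i /andP[/andP[ni _] _]; rewrite ltn_log0.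
Qed.

Lemma OmegaM (a b : nat) : (0 < a)%N -> (0 < b)%N -> Omega (a * b) = (Omega a + Omega b)%N.
Proof.
move=> a0 b0; rewrite (@Omega_widen a (a * b).+1) ?ltnS ?leq_pmulr//.
rewrite (@Omega_widen b (a * b).+1) ?ltnS ?leq_pmull// /Omega -big_split/=.
by apply: eq_bigr => p _; rewrite lognM.
Qed.

Lemma Omega_prime (p : nat) : prime p -> Omega p = 1%N.
Proof.
move=> pp; rewrite /Omega (bigD1 ord_max)//= logn_prime// eqxx big1 ?addn0// => i.
by rewrite logn_prime// => /negbTE ip; rewrite [_ == _ :> nat]ip.
Qed.

Lemma Omega1 : Omega 1 = 0%N.
Proof. by rewrite /Omega big1// => i _; rewrite logn1. Qed.

(** * Finite Euler products against partial sums *)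

Lemma ler_sum_subset (R : numDomainType) (I : eqType) (s t : seq I) (g : I -> R) :
  uniq s -> {subset s <= t} -> (forall i, i \in t -> 0 <= g i) ->
  \sum_(i <- s) g i <= \sum_(i <- t) g i.
Proof.
elim: s t => [|x s IH] t /=.
  by move=> _ _ g0; rewrite big_nil big_seq sumr_ge0.
move=> /andP[xs us] st g0.
have xt : x \in t by apply: st; rewrite mem_head.
rewrite big_cons (big_rem _ xt)/= lerD2l; apply: IH => //.
  move=> y ys; have := st y; rewrite inE ys orbT => /(_ isT).
  rewrite (perm_mem (perm_to_rem xt)) inE => /predU1P[yx|//].
  by rewrite -yx ys in xs.
by move=> i /mem_rem; apply: g0.
Qed.

Section smooth_sums.
Context {R : realFieldType}.
Variable g : nat -> R.
Hypothesis g_ge0 : forall n, 0 <= g n.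
Hypothesis g1 : g 1 = 1.
Hypothesis gM : forall p m, prime p -> (0 < m)%N -> g (p * m)%N = g p * g m.

(** Induction on [ps]: division by [p] sends the multiples of [p] injectively into the same range,
    so the sum S satisfies S <= P + g(p) S, with P the product over the other primes; then solve for
    S. *)
Lemma sum_smooth_le (X : nat) (ps : seq nat) :
  (forall p, p \in ps -> prime p /\ g p < 1) ->
  \sum_(1 <= n < X.+1 | all [in ps] (primes n)) g n <= \prod_(p <- ps) (1 - g p)^-1.
Proof.
elim: ps => [_|p ps IH Hps].
  rewrite big_nil -big_filter.
  apply: (@le_trans _ _ (\sum_(n <- [:: 1%N]) g n)); last by rewrite big_seq1 g1.
  apply: ler_sum_subset => //; first by rewrite filter_uniq ?iota_uniq.
  move=> n; rewrite mem_filter mem_index_iota => /andP[nn /andP[n0 _]].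
  rewrite inE; case: (ltngtP n 1%N) => //; first lia.
  move=> n1; have := pdiv_prime n1 => pp.
  have : pdiv n \in primes n by rewrite mem_primes pp n0 pdiv_dvd.
  by move/(allP nn).
have [pp gp] := Hps p (mem_head _ _).
have {}IH := IH (fun q qps => Hps q (mem_behead (s := p :: ps) qps)).
set S := (X in X <= _); rewrite big_cons mulrC ler_pdivlMr ?subr_gt0//.
suff : S <= \prod_(q <- ps) (1 - g q)^-1 + g p * S by rewrite mulrBr mulr1; lra.
rewrite [leLHS](bigID (fun n => p %| n)%N)/= addrC lerD//.
  apply: le_trans IH; rewrite -big_filter -[leRHS]big_filter.
  apply: ler_sum_subset => //; first by rewrite filter_uniq ?iota_uniq.
  move=> n; rewrite !mem_filter => /andP[/andP[/allP nn pn] ->]; rewrite andbT.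
  apply/allP => q qn; have := nn q qn; rewrite !inE => /predU1P[qp|//].
  by move: qn pn; rewrite qp mem_primes => /and3P[_ _ ->].
rewrite -big_filter (eq_big_seq (fun n => g p * g (n %/ p)%N)); last first.
  move=> n; rewrite mem_filter mem_index_iota => /andP[/andP[_ pn] /andP[n0 _]].
  rewrite -gM// ?divn_gt0 ?prime_gt0 ?(dvdn_leq n0)//.
  by rewrite mulnC divnK.
rewrite -big_distrr/= ler_wpM2l//.
rewrite -(big_map (fun n => n %/ p)%N xpredT g) /S -[leRHS]big_filter.
apply: ler_sum_subset => //.
  rewrite map_inj_in_uniq ?filter_uniq ?iota_uniq// => m n.
  rewrite !mem_filter => /andP[/andP[_ pm] _] /andP[/andP[_ pn] _] mn.
  by rewrite -(divnK pm) mn divnK.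
move=> _ /mapP[n + ->].
rewrite !mem_filter !mem_index_iota => /andP[/andP[/allP nn pn] /andP[n0 nX]].
rewrite divn_gt0 ?prime_gt0// (dvdn_leq n0 pn)/= (leq_ltn_trans (leq_div _ _))// andbT.
apply/allP => q; rewrite mem_primes => /and3P[pq _ qn]; apply: nn.
by rewrite mem_primes pq n0/= (dvdn_trans qn)// -{2}(divnK pn) dvdn_mulr.
Qed.

(** For distinct primes these are the squarefree numbers with all prime factors in [ps], which index
    the expansion of the product of the 1 + g(p). *)
Fixpoint subset_products (ps : seq nat) : seq nat :=
  if ps is p :: ps' then subset_products ps' ++ map (muln p) (subset_products ps')
  else [:: 1%N].

Lemma subset_products_spec (ps : seq nat) : uniq ps -> all prime ps ->
  uniq (subset_products ps) /\ (forall n, n \in subset_products ps ->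
    (0 < n)%N /\ forall q, prime q -> (q %| n)%N -> q \in ps).
Proof.
elim: ps => [_ _|p ps IH /= /andP[pps ups] /andP[pp aps]].
  by split=> // n; rewrite inE => /eqP->; split => // q pq; rewrite dvdn1 => /eqP q1; rewrite q1 in pq.
have [uL HL] := IH ups aps; split.
  rewrite cat_uniq uL/= map_inj_uniq ?uL ?andbT; last first.
    by move=> m n /eqP; rewrite eqn_pmul2l ?prime_gt0// => /eqP.
  apply/hasPn => _ /mapP[n nL ->]; apply/negP => /HL[_ /(_ p pp)].
  by rewrite dvdn_mulr// => /(_ isT); apply/negP.
move=> n; rewrite mem_cat => /orP[/HL[n0 H]|/mapP[m /HL[m0 H] ->]].
  by split => // q pq qn; rewrite inE H ?orbT.
split; first by rewrite muln_gt0 prime_gt0.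
move=> q pq; rewrite Euclid_dvdM// => /orP[|qm]; last by rewrite inE H ?orbT.
by rewrite dvdn_prime2// => /eqP ->; rewrite mem_head.
Qed.

Lemma sum_subset_products (ps : seq nat) : uniq ps -> all prime ps ->
  \sum_(n <- subset_products ps) g n = \prod_(p <- ps) (1 + g p).
Proof.
elim: ps => [_ _|p ps IH /= /andP[pps ups] /andP[pp aps]].
  by rewrite big_nil big_seq1.
rewrite big_cat/= big_map big_cons -IH// mulrDl mul1r; congr (_ + _).
rewrite big_distrr/=; apply: eq_big_seq => n nL; apply: gM => //.
by have [_ /(_ _ nL)[]] := subset_products_spec ps ups aps.
Qed.

Lemma prod_1D_le (B : R) (ps : seq nat) : uniq ps -> all prime ps ->
  (forall X, \sum_(1 <= n < X.+1) g n <= B) -> \prod_(p <- ps) (1 + g p) <= B.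
Proof.
move=> ups aps HB; rewrite -sum_subset_products//.
have [uL HL] := subset_products_spec ps ups aps.
apply: le_trans (HB (\max_(n <- subset_products ps) n)%N).
apply: ler_sum_subset => // n nL.
by rewrite mem_index_iota ltnS (HL _ nL).1/= leq_bigmax_seq.
Qed.

End smooth_sums.

(** * Logarithmic means of x^Omega(n) *)

Section logarithmic_sums.
Context {R : realType}.
Implicit Types (x sigma : R) (n p : nat).

(** This is n^(-1-sigma) for n >= 1; the convention ln 0 = 0 gives the value 1 at n = 0. *)
Definition npow sigma n : R := expR (- (1 + sigma) * ln n%:R).

Lemma npow_ge0 sigma n : 0 <= npow sigma n.
Proof. exact: expR_ge0. Qed.

Lemma npow1 sigma : npow sigma 1 = 1.
Proof. by rewrite /npow ln1 mulr0 expR0. Qed.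

Lemma npowM sigma m n : (0 < m)%N -> (0 < n)%N ->
  npow sigma (m * n) = npow sigma m * npow sigma n.
Proof. by move=> m0 n0; rewrite /npow natrM lnM ?posrE ?ltr0n// mulrDr expRD. Qed.

Lemma ln_natr_ge0 n : 0 <= ln n%:R :> R.
Proof.
case: n => [|n]; first by rewrite ln0.
by rewrite ln_ge0// ler1n.
Qed.

Lemma npow_le_inv sigma n : 0 <= sigma -> (0 < n)%N -> npow sigma n <= n%:R^-1.
Proof.
move=> s0 n0; rewrite -[leRHS](@lnK R) ?posrE ?invr_gt0 ?ltr0n//.
rewrite lnV ?posrE ?ltr0n// /npow ler_expR mulNr lerN2 ler_peMl ?ln_natr_ge0//.
by rewrite lerDl.
Qed.

Lemma sum_npow_le sigma X : 0 < sigma ->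
  \sum_(1 <= n < X.+1) npow sigma n <= 1 + sigma^-1.
Proof.
move=> s0; case: X => [|X]; first by rewrite big_geq// addr_ge0// invr_ge0 ltW.
(* The subtracted term is the integral of t^(-1-sigma) beyond the last index; with it the induction
   closes. *)
suff : \sum_(1 <= n < X.+2) npow sigma n
    <= 1 + sigma^-1 - sigma^-1 * expR (- sigma * ln X.+1%:R).
  by move=> /le_trans; apply; rewrite gerBl mulr_ge0 ?invr_ge0 ?expR_ge0// ltW.
elim: X => [|X IH]; first by rewrite big_nat1 npow1 ln1 mulr0 expR0; lra.
rewrite big_nat_recr//=.
set N : R := X.+2%:R; set n : R := X.+1%:R.
have Nn : N = n + 1 by rewrite /N -natr1.
have n0 : 0 < n by rewrite ltr0n.
have N0 : 0 < N by rewrite ltr0n.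
have lnNn : ln n <= ln N - N^-1.
  have -> : n = N * (1 - N^-1) by rewrite mulrBr mulr1 mulfV ?gt_eqF// Nn addrK.
  have N1 : N^-1 < 1 by rewrite invf_lt1// Nn ltrDr.
  rewrite lnM ?posrE ?subr_gt0//; rewrite lerD2l.
  by apply: le_ln1Dx; rewrite ltrN2.
have step : sigma * npow sigma X.+2 <= expR (- sigma * ln n) - expR (- sigma * ln N).
  have -> : npow sigma X.+2 = expR (- sigma * ln N) * N^-1.
    by rewrite /npow -/N opprD mulrDl mulN1r addrC expRD [expR (- ln N)]expRN lnK.
  rewrite lerBrDr; apply: le_trans (_ : expR (- sigma * ln N) * (1 + sigma / N) <= _).
    by rewrite le_eqVlt; apply/orP; left; apply/eqP; ring.
  have -> : - sigma * ln n = - sigma * ln N + sigma * (ln N - ln n) by ring.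
  rewrite [leRHS]expRD ler_wpM2l ?expR_ge0// (le_trans _ (expR_ge1Dx _))//.
  rewrite lerD2l (ler_wpM2l (ltW s0))//.
  by move: lnNn; move: (ln n) (ln N) N^-1 => *; lra.
rewrite -(ler_pM2l s0) in IH; rewrite -(ler_pM2l s0).
move: IH; rewrite -/n !mulrDr !mulrN !mulrA mulfV ?gt_eqF// !mul1r.
move: step; lra.
Qed.

(** The product of the 1 + w, with w = [npow sigma p], is at most the bound for zeta(1 + sigma), and
    w - w^2 <= ln(1 + w) turns it into a sum. *)
Lemma sum_npow_prime_le sigma (ps : seq nat) : 0 < sigma -> uniq ps -> all prime ps ->
  \sum_(p <- ps) npow sigma p <= ln (1 + sigma^-1) + \sum_(p <- ps) npow sigma p ^+ 2.
Proof.
move=> s0 ups aps.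
have B0 : 0 < 1 + sigma^-1 by rewrite addr_gt0// invr_gt0.
rewrite -lerBlDr -ler_expR lnK ?posrE//.
rewrite -sumrB expR_sum.
apply: le_trans (prod_1D_le (npow sigma) _ _ _ _ _ ups aps _); first last.
- by move=> X; apply: sum_npow_le.
- by move=> p m pp m0; rewrite npowM// prime_gt0.
- exact: npow1.
- exact: npow_ge0.
apply: ler_prod => p _; rewrite expR_ge0/=.
set w := npow sigma p.
have w0 : 0 <= w := npow_ge0 _ _.
(* It is enough that exp(w - w^2) <= 1/(1 - w + w^2), because (1 + w)(1 - w + w^2) = 1 + w^3 >=
   1. *)
have t1 : 0 < 1 - (w - w ^+ 2) by nra.
have := expR_ge1Dx (- (w - w ^+ 2)); rewrite expRN => h.
have h2 : expR (w - w ^+ 2) * (1 - (w - w ^+ 2)) <= 1.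
  by rewrite -ler_pdivlMl ?expR_gt0// mulr1.
rewrite -(ler_pM2r t1); apply: (le_trans h2); nra.
Qed.

Lemma sum_npow_prime_sqr_le sigma (ps : seq nat) : 0 < sigma -> uniq ps -> all prime ps ->
  \sum_(p <- ps) npow sigma p ^+ 2 <= 2.
Proof.
move=> s0 ups aps.
apply: le_trans (_ : \sum_(p <- ps) npow 1 p <= _).
  rewrite big_seq_cond [leRHS]big_seq_cond; apply: ler_sum => p /andP[pps _].
  rewrite expr2 -expRD -mulrDl ler_expR ler_wpM2r ?ln_natr_ge0//; lra.
have := sum_npow_le 1 (\max_(p <- ps) p) ltr01; rewrite invr1 => h.
apply: le_trans (_ : 1 + 1 <= _); last by lra.
apply: le_trans h; apply: ler_sum_subset => //; last by move=> *; exact: npow_ge0.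
move=> p pps; rewrite mem_index_iota ltnS leq_bigmax_seq// andbT.
by rewrite prime_gt0// (allP aps).
Qed.

(** Here 1/(1 - xw) = 1 + xw + (xw)^2/(1 - xw), and w <= 1/2, true of p^(-1-sigma), keeps the last
    denominator at least 1 - x/2. *)
Lemma inv_1B_le x (w : R) : 0 < x < 2 -> 0 <= w <= 2^-1 ->
  (1 - x * w)^-1 <= expR (x * w + x ^+ 2 / (1 - x / 2) * w ^+ 2).
Proof.
move=> /andP[x0 x2] /andP[w0 w1].
have d0 : 0 < 1 - x / 2 by lra.
have d1 : 1 - x / 2 <= 1 - x * w by nra.
have d2 := lt_le_trans d0 d1.
have -> : (1 - x * w)^-1 = 1 + (x * w + x ^+ 2 / (1 - x * w) * w ^+ 2).
  by field; rewrite gt_eqF.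
apply: le_trans (expR_ge1Dx _) _; rewrite ler_expR lerD2l.
rewrite ler_wpM2r ?sqr_ge0// ler_wpM2l ?sqr_ge0//.
by rewrite lef_pV2 ?posrE.
Qed.

(* Rankin's trick: with sigma = 1/K the factor n^sigma is at most 2 for n <= 2^K,
   and the Euler product of x^Omega(n) n^(-1-sigma) is O(zeta(1+sigma)^x). *)
Lemma log_sum_Omega_le x : 0 < x < 2 -> exists2 C : R, 0 < C & forall K, (0 < K)%N ->
  \sum_(1 <= n < (2 ^ K).+1) x ^+ Omega n / n%:R <= C * expR (x * ln K%:R).
Proof.
move=> /[dup] x02 /andP[x0 x2].
set D : R := x ^+ 2 / (1 - x / 2).
have D0 : 0 <= D by rewrite divr_ge0 ?sqr_ge0//; lra.
(* The leading 2 is Rankin's loss; ln 2 comes from ln(1 + K) <= ln 2 + ln K, the other two 2's from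
   the sum of squares over primes. *)
exists (2 * expR (x * (ln 2 + 2) + D * 2)) => [|K K0]; first by rewrite mulr_gt0 ?expR_gt0.
pose sigma : R := K%:R^-1.
have KR : 0 < K%:R :> R by rewrite ltr0n.
have s0 : 0 < sigma by rewrite invr_gt0.
pose g n := x ^+ Omega n * npow sigma n.
have g0 n : 0 <= g n by rewrite mulr_ge0 ?npow_ge0// exprn_ge0// ltW.
apply: le_trans (_ : 2 * \sum_(1 <= n < (2 ^ K).+1) g n <= _).
  rewrite big_distrr/= big_nat_cond [leRHS]big_nat_cond; apply: ler_sum => n.
  rewrite andbT ltnS => /andP[n0 nK].
  rewrite /g mulrCA (ler_wpM2l (exprn_ge0 _ (ltW x0)))//.
  have nR : 0 < n%:R :> R by rewrite ltr0n.
  rewrite -[leLHS]lnK ?posrE ?invr_gt0// lnV ?posrE// /npow.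
  rewrite -{1}[2]lnK ?posrE// -expRD ler_expR.
  suff : sigma * ln n%:R <= ln 2 by lra.
  rewrite /sigma mulrC ler_pdivrMr// mulr_natr -lnXn// ler_ln ?posrE ?exprn_gt0//.
  by rewrite -natrX ler_nat.
rewrite -mulrA ler_pM2l//.
pose ps := [seq p <- index_iota 1 (2 ^ K).+1 | prime p].
have ups : uniq ps by rewrite filter_uniq ?iota_uniq.
have aps : all prime ps by apply/allP => p; rewrite mem_filter => /andP[].
have gE p : prime p -> g p = x * npow sigma p by move=> pp; rewrite /g Omega_prime.
have wp p : prime p -> 0 <= npow sigma p <= 2^-1.
  move=> pp; rewrite npow_ge0/= (le_trans (npow_le_inv _ _ (ltW s0) (prime_gt0 pp)))//.
  by rewrite lef_pV2 ?posrE ?ltr0n ?prime_gt0// ler_nat prime_gt1.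
have gps p : p \in ps -> prime p /\ g p < 1.
  move=> /(allP aps) pp; split => //; rewrite gE//.
  by have /andP[] := wp _ pp; nra.
apply: le_trans (_ : \prod_(p <- ps) (1 - g p)^-1 <= _).
  apply: le_trans (sum_smooth_le g _ _ _ (2 ^ K) ps gps) => //.
  - rewrite [leRHS]big_mkcond/= big_nat_cond [leRHS]big_nat_cond; apply: ler_sum => n.
    rewrite andbT => /andP[n0 nK]; rewrite ifT//; apply/allP => p.
    rewrite mem_primes => /and3P[pp _ pn] /=; rewrite mem_filter pp mem_index_iota.
    by rewrite prime_gt0//= (leq_ltn_trans (dvdn_leq n0 pn)).
  - by rewrite /g Omega1 npow1 expr0 mulr1.
  - by move=> p m pp m0; have p0 := prime_gt0 pp; rewrite /g OmegaM// npowM// exprD mulrACA.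
apply: le_trans (_ : \prod_(p <- ps) expR (x * npow sigma p + D * npow sigma p ^+ 2) <= _).
  rewrite big_seq_cond [leRHS]big_seq_cond; apply: ler_prod => p /andP[/[dup] pps /gps[pp gp] _].
  by rewrite invr_ge0 subr_ge0 ltW//= gE// inv_1B_le// wp.
rewrite -expR_sum -expRD ler_expR big_split/= -!big_distrr/=.
have S2 := sum_npow_prime_sqr_le _ _ s0 ups aps.
have S1 := sum_npow_prime_le _ _ s0 ups aps.
have lnK1 : ln (1 + sigma^-1) <= ln 2 + ln K%:R.
  rewrite -lnM ?posrE// ler_ln ?posrE ?mulr_gt0 ?addr_gt0 ?invr_gt0// invrK.
  by have : 1 <= K%:R :> R by [rewrite ler1n]; lra.
have : D * \sum_(p <- ps) npow sigma p ^+ 2 <= D * 2 by rewrite ler_wpM2l.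
have : x * \sum_(p <- ps) npow sigma p <= x * (ln 2 + ln K%:R + 2).
  by rewrite (ler_wpM2l (ltW x0))//; lra.
lra.
Qed.

End logarithmic_sums.

(** * The multiplication table and its size *)

Definition mul_table (X : nat) : seq nat :=
  undup [seq (a * b)%N | a <- index_iota 1 X.+1, b <- index_iota 1 X.+1].

Lemma mul_tableP (X n : nat) : reflect
  (exists a b, [/\ (0 < a <= X)%N, (0 < b <= X)%N & n = (a * b)%N]) (n \in mul_table X).
Proof.
rewrite mem_undup; apply: (iffP allpairsP) => [[[a b] /= []]|[a [b [aX bX ->]]]].
  by rewrite !mem_index_iota !ltnS => aX bX ->; exists a, b.
by exists (a, b); rewrite !mem_index_iota !ltnS.
Qed.

Section table_count.
Context {R : realType}.
Implicit Types (x y z L : R).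

(** Each f(n) is counted with the weights 2^(-k) for 2^k >= n, which total at most 2/n. *)
Lemma dyadic_average (f : nat -> R) (M : nat) : (forall n, 0 <= f n) ->
  \sum_(0 <= k < M.+1) (\sum_(1 <= n < (2 ^ k).+1) f n) / 2 ^+ k <=
  2 * \sum_(1 <= n < (2 ^ M).+1) f n / n%:R.
Proof.
move=> f0.
(* The subtracted term accounts for the scales beyond M, since the 2^(-k) with k > M sum to
   2^(-M). *)
suff : \sum_(0 <= k < M.+1) (\sum_(1 <= n < (2 ^ k).+1) f n) / 2 ^+ k <=
    2 * \sum_(1 <= n < (2 ^ M).+1) f n / n%:R - (\sum_(1 <= n < (2 ^ M).+1) f n) / 2 ^+ M.
  by move=> /le_trans; apply; rewrite gerBl divr_ge0 ?sumr_ge0// exprn_ge0.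
elim: M => [|M IH]; first by rewrite !big_nat1 expr0 !divr1; lra.
rewrite big_nat_recr//=.
have le2 : ((2 ^ M).+1 <= (2 ^ M.+1).+1)%N by rewrite ltnS leq_exp2l.
have cat (h : nat -> R) : \sum_(1 <= n < (2 ^ M.+1).+1) h n =
    \sum_(1 <= n < (2 ^ M).+1) h n + \sum_((2 ^ M).+1 <= n < (2 ^ M.+1).+1) h n.
  by rewrite (big_cat_nat _ le2).
rewrite !cat.
set S := \sum_(1 <= n < (2 ^ M).+1) f n in IH *.
set F := \sum_(1 <= n < (2 ^ M).+1) f n / n%:R in IH *.
set dS := \sum_((2 ^ M).+1 <= n < (2 ^ M.+1).+1) f n.
set dF := \sum_((2 ^ M).+1 <= n < (2 ^ M.+1).+1) f n / n%:R.
have dFS : dS / 2 ^+ M.+1 <= dF.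
  rewrite /dS big_distrl/= /dF big_nat_cond [leRHS]big_nat_cond; apply: ler_sum => n.
  rewrite andbT !ltnS => /andP[n0 n1]; apply: ler_wpM2l => //.
  have nR : 0 < n%:R :> R by rewrite ltr0n (leq_ltn_trans _ n0).
  by rewrite lef_pV2 ?posrE ?exprn_gt0// -natrX ler_nat.
move: dFS IH; set T := \sum_(0 <= k < M.+1) _.
by rewrite exprS invfM; move: (2 ^+ M)^-1 => q; lra.
Qed.

Lemma exists_le_mean (h : nat -> R) (D : R) (K : nat) : (0 < K)%N ->
  \sum_(K <= k < 2 * K) h k <= D -> exists2 k, (K <= k < 2 * K)%N & h k <= D / K%:R.
Proof.
move=> K0; apply: contra_leP => H.
have K0R : 0 < K%:R :> R by rewrite ltr0n.
have -> : D = \sum_(K <= k < 2 * K) D / K%:R.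
  rewrite sumr_const_nat (_ : 2 * K - K = K)%N; last lia.
  by rewrite -(mulr_natr (D / K%:R)) divfK ?gt_eqF.
apply: ltr_sum_nat; first lia.
by move=> k kK; rewrite ltNge; apply/negP => hk; apply: H; exists k.
Qed.

(** Each entry has weight at least 1: z^(Omega(n) - L) if Omega(n) >= L, and y^(Omega(n) - L)
    otherwise. The second sum is enlarged to all pairs (a, b), where additivity of [Omega] produces
    the square. *)
Lemma mul_table_size_le z y L (X : nat) : 1 <= z -> 0 < y <= 1 ->
  (size (mul_table X))%:R <=
    expR (- L * ln z) * \sum_(1 <= n < (X * X).+1) z ^+ Omega n +
    expR (- L * ln y) * (\sum_(1 <= n < X.+1) y ^+ Omega n) ^+ 2.
Proof.
move=> z1 /andP[y0 y1]; have z0 : 0 < z by apply: lt_le_trans z1.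
rewrite -sum1_size natr_sum.
apply: le_trans (_ : \sum_(n <- mul_table X)
  (expR (- L * ln z) * z ^+ Omega n + expR (- L * ln y) * y ^+ Omega n) <= _).
  apply: ler_sum => n _.
  have key x : 0 < x -> expR (- L * ln x) * x ^+ Omega n = expR (((Omega n)%:R - L) * ln x).
    by move=> x0; rewrite -{2}(@lnK _ x) ?posrE// -expRM_natl -expRD; congr expR; ring.
  rewrite !key//; have [LO|OL] := leP L (Omega n)%:R.
    by rewrite ler_wpDr ?expR_ge0// -[leLHS]expR0 ler_expR mulr_ge0 ?subr_ge0// ln_ge0//.
  rewrite ler_wpDl ?expR_ge0// -[leLHS]expR0 ler_expR mulr_le0 ?ln_le0//.
  by rewrite subr_le0 ltW.
rewrite big_split/= lerD// -big_distrr/= ler_wpM2l ?expR_ge0//.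
  apply: ler_sum_subset => [||n _]; [exact: undup_uniq| |by rewrite exprn_ge0 ?ltW].
  move=> n /mul_tableP[a [b [/andP[a0 aX] /andP[b0 bX] ->]]].
  by rewrite mem_index_iota ltnS muln_gt0 a0 b0 leq_mul.
apply: le_trans (_ : \sum_(n <- [seq (a * b)%N | a <- index_iota 1 X.+1,
    b <- index_iota 1 X.+1]) y ^+ Omega n <= _).
  apply: ler_sum_subset => [||n _]; [exact: undup_uniq| |by rewrite exprn_ge0 ?ltW].
  by move=> n; rewrite mem_undup.
rewrite big_allpairs_dep expr2 big_distrl/= big_nat_cond [leRHS]big_nat_cond.
apply: ler_sum => a; rewrite andbT => /andP[a0 _].
rewrite big_distrr/= big_nat_cond [leRHS]big_nat_cond; apply: ler_sum => b.
by rewrite andbT => /andP[b0 _]; rewrite OmegaM// exprD.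
Qed.

End table_count.

(** * The exponent c and Erdos' bound at infinitely many scales *)

Section exponent.
Context {R : realType}.

Lemma ln2_gt_half : 2^-1 < ln 2 :> R.
Proof.
rewrite -ltr_expR lnK ?posrE//.
have := @expR_gt1Dx R (- 2^-1) _; rewrite oppr_eq0 invr_eq0 pnatr_eq0 => /(_ isT).
rewrite expRN => h; have e0 := expR_gt0 (2^-1 : R).
rewrite -ltf_pV2 ?posrE//; lra.
Qed.

Lemma ln2_lt1 : ln 2 < 1 :> R.
Proof. by rewrite -ltr_expR lnK ?posrE//; have := @expR_gt1Dx R 1 (oner_neq0 _); lra. Qed.

Definition inv_ln2 : R := (ln 2)^-1.

Lemma inv_ln2_bounds : 1 < inv_ln2 < 2.
Proof.
have h := ln2_gt_half; have h1 := ln2_lt1.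
have h0 : 0 < ln 2 :> R by lra.
by rewrite /inv_ln2 invf_gt1// h1/= -[ltRHS]invrK ltf_pV2 ?posrE ?invr_gt0.
Qed.

(** With z = 1/log 2, log(e log 2) = 1 - log z; this is the form in which c leaves the balance of
    exponents. *)
Lemma c_expE : c_exp = 1 - inv_ln2 + inv_ln2 * ln inv_ln2 :> R.
Proof.
have h0 : 0 < ln 2 :> R by have := ln2_gt_half; lra.
rewrite /c_exp lnM ?posrE ?expR_gt0// expRK /inv_ln2 lnV ?posrE//; ring.
Qed.

Lemma c_exp_ge0 : 0 <= c_exp :> R.
Proof.
rewrite c_expE; have /andP[z1 z2] := inv_ln2_bounds; set z := inv_ln2 in z1 z2 *.
have zi : 0 < z^-1 by rewrite invr_gt0; lra.
have := @le_ln1Dx R (z^-1 - 1) _; rewrite addrCA subrr addr0 lnV ?posrE; last lra.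
move=> h; have {}h : - ln z <= z^-1 - 1 by apply: h; lra.
have : z * (1 - z^-1) <= z * ln z by apply: ler_wpM2l; lra.
by rewrite mulrBr mulr1 mulfV ?gt_eqF//; lra.
Qed.

Lemma c_exp_le1 : c_exp <= 1 :> R.
Proof.
rewrite c_expE; have /andP[z1 z2] := inv_ln2_bounds; set z := inv_ln2 in z1 z2 *.
have : ln z <= 1.
  by have := @le_ln1Dx R (z - 1) _; rewrite addrCA subrr addr0 => h; have := h _; lra.
by move=> h; have : z * ln z <= z * 1 by [apply: ler_wpM2l => //; lra]; lra.
Qed.

(* At the threshold L = z ln K the two terms of [mul_table_size_le] with y = z/2
   balance: z - 1 - z ln z = 2 (y - 1) - z ln y = - c. *)
Lemma mul_table_sparse : exists2 C : R, 0 < C & forall K0 : nat, exists k : nat,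
  [/\ (K0 <= k)%N, (0 < k)%N &
      (size (mul_table (2 ^ k)))%:R <= C * 4 ^+ k * expR (- c_exp * ln k%:R)].
Proof.
have dbl_inj : injective (fun k => 2 * k)%N by move=> m n; lia.
have dbl_in (K k : nat) : (K <= k < 2 * K)%N -> (2 * k < (4 * K).+1)%N by lia.
have /andP[z1 z2] := inv_ln2_bounds; set z := inv_ln2 in z1 z2 *.
have [y yE] : exists y, y = z / 2 by exists (z / 2).
have z0 : 0 < z by lra.
have y0 : 0 < y by lra.
have y1 : y < 1 by lra.
have zln2 : z * ln 2 = 1 by rewrite /z /inv_ln2 mulVf// gt_eqF//; have := ln2_gt_half; lra.
have [|Cz Cz0 HCz] := @log_sum_Omega_le R z; first by rewrite z0.
have [|Cy Cy0 HCy] := @log_sum_Omega_le R y; first by rewrite y0/=; lra.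
(* For K <= k < 2K the [z] means are taken at 2k < 4K, since entries reach (2^k)^2, and the [y]
   means at k < 2K: hence ln 4 and ln 2. The factors 2 come from [dyadic_average]. *)
pose D := 2 * Cz * expR (z * ln 4) + 2 * Cy * expR (y * ln 2).
have D0 : 0 < D by rewrite addr_gt0// !mulr_gt0 ?expR_gt0.
(* D serves the [z] term, D^2 the squared [y] term, and 2^c pays for passing from K to k < 2K. *)
exists ((D + D ^+ 2) * expR (c_exp * ln 2)) => [|K0].
  by rewrite mulr_gt0 ?expR_gt0// addr_gt0// exprn_gt0.
pose K := K0.+1; pose t : R := ln K%:R.
have KR : 0 < K%:R :> R by rewrite ltr0n.
pose Sz k : R := (\sum_(1 <= n < (2 ^ k).+1) z ^+ Omega n) / 2 ^+ k.
pose Sy k : R := (\sum_(1 <= n < (2 ^ k).+1) y ^+ Omega n) / 2 ^+ k.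
have Sz0 k : 0 <= Sz k by rewrite divr_ge0 ?sumr_ge0// => n _; rewrite exprn_ge0// ltW.
have Sy0 k : 0 <= Sy k by rewrite divr_ge0 ?sumr_ge0// => n _; rewrite exprn_ge0// ltW.
have avgz : \sum_(K <= k < 2 * K) Sz (2 * k)%N <= 2 * Cz * expR (z * ln 4) * expR (z * t).
  apply: le_trans (_ : \sum_(0 <= j < (4 * K).+1) Sz j <= _).
    rewrite -(big_map (fun k => 2 * k)%N xpredT Sz); apply: ler_sum_subset => //.
      by rewrite map_inj_uniq ?iota_uniq.
    by move=> _ /mapP[k + ->]; rewrite !mem_index_iota => /dbl_in.
  apply: le_trans (dyadic_average _ _ _) _ => [n|]; first by rewrite exprn_ge0// ltW.
  rewrite -!mulrA ler_pM2l// (le_trans (HCz _ _))// ler_pM2l// -expRD ler_expR.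
  by rewrite -mulrDr ler_pM2l// natrM lnM ?posrE.
have avgy : \sum_(K <= k < 2 * K) Sy k <= 2 * Cy * expR (y * ln 2) * expR (y * t).
  apply: le_trans (_ : \sum_(0 <= j < (2 * K).+1) Sy j <= _).
    apply: ler_sum_subset => //; first exact: iota_uniq.
    by move=> k; rewrite !mem_index_iota => /andP[_ /ltnW].
  apply: le_trans (dyadic_average _ _ _) _ => [n|]; first by rewrite exprn_ge0// ltW.
  rewrite -!mulrA ler_pM2l// (le_trans (HCy _ _))// ler_pM2l// -expRD ler_expR.
  by rewrite -mulrDr ler_pM2l// natrM lnM ?posrE.
(* Averaging the sum of both normalized means gives one k that is good for both, as each summand is
   nonnegative. *)
have [|k /andP[Kk k2K] hk] :=
    @exists_le_mean R (fun k => expR (- (z * t)) * Sz (2 * k)%N + expR (- (y * t)) * Sy k) D K isT.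
  rewrite big_split/= -!big_distrr/= lerD//.
    by rewrite expRN ler_pdivrMl ?expR_gt0// mulrC.
  by rewrite expRN ler_pdivrMl ?expR_gt0// mulrC.
have k0 : (0 < k)%N := leq_ltn_trans (leq0n K0) Kk.
exists k; split => //; first exact: ltnW.
have Kt : K%:R^-1 = expR (- t) :> R by rewrite expRN lnK.
have hz : Sz (2 * k)%N <= D * expR ((z - 1) * t).
  have : expR (- (z * t)) * Sz (2 * k)%N <= D * expR (- t).
    by rewrite -Kt (le_trans _ hk)// lerDl mulr_ge0 ?expR_ge0.
  rewrite expRN ler_pdivrMl ?expR_gt0// => /le_trans; apply.
  by rewrite mulrCA -expRD ler_pM2l// ler_expR; lra.
have hy : Sy k <= D * expR ((y - 1) * t).
  have : expR (- (y * t)) * Sy k <= D * expR (- t).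
    by rewrite -Kt (le_trans _ hk)// lerDr mulr_ge0 ?expR_ge0.
  rewrite expRN ler_pdivrMl ?expR_gt0// => /le_trans; apply.
  by rewrite mulrCA -expRD ler_pM2l// ler_expR; lra.
have := @mul_table_size_le R z y (z * t) (2 ^ k) (ltW z1).
rewrite y0 ltW// => /(_ isT) /le_trans; apply.
have -> : (2 ^ k * 2 ^ k = 2 ^ (2 * k))%N by rewrite -expnD addnn mul2n.
have -> : \sum_(1 <= n < (2 ^ (2 * k)).+1) z ^+ Omega n = Sz (2 * k)%N * 4 ^+ k.
  by rewrite /Sz exprM -(natrX _ 2 2) divfK// expf_neq0.
have -> : \sum_(1 <= n < (2 ^ k).+1) y ^+ Omega n = Sy k * 2 ^+ k.
  by rewrite /Sy divfK// expf_neq0.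
have four : (2 ^+ k) ^+ 2 = 4 ^+ k :> R by rewrite -exprM mulnC exprM -(natrX _ 2 2).
rewrite exprMn four [X in X + _]mulrA [X in _ + X]mulrA -mulrDl.
rewrite [leRHS](_ : _ = ((D + D ^+ 2) * expR (c_exp * ln 2) * expR (- c_exp * ln k%:R)) * 4 ^+ k); last by ring.
rewrite ler_wpM2r ?exprn_ge0//.
apply: le_trans (_ : (D + D ^+ 2) * expR (- c_exp * t) <= _); last first.
  rewrite -mulrA -expRD; apply: ler_wpM2l; first by rewrite addr_ge0 ?exprn_ge0// ltW.
  rewrite ler_expR.
  have : ln k%:R <= t + ln 2.
    by rewrite /t -lnM ?posrE// ler_ln ?posrE ?ltr0n ?mulr_gt0// -natrM ler_nat mulnC ltnW.
  move=> h; have := c_exp_ge0; nra.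
rewrite mulrDl; apply: lerD.
  apply: le_trans (ler_wpM2l (expR_ge0 _) hz) _.
  by rewrite mulrCA -expRD ler_pM2l// ler_expR c_expE -/z; lra.
have hy2 : Sy k ^+ 2 <= D ^+ 2 * expR (2 * ((y - 1) * t)).
  rewrite [expR (2 * _)]expRM_natl -exprMn; apply: lerXn2r => //; rewrite nnegrE//.
  by rewrite mulr_ge0 ?expR_ge0// ltW.
apply: le_trans (ler_wpM2l (expR_ge0 _) hy2) _.
rewrite mulrCA -expRD ler_pM2l ?exprn_gt0// ler_expR c_expE -/z.
rewrite yE lnM ?posrE// lnV ?posrE//.
(* Now z ln 2 = 1 combines with 2(y - 1) = z - 2 to leave z - 1 - z ln z = - c. *)
have -> : - (z * t) * (ln z - ln 2) = - (z * t * ln z) + (z * ln 2) * t by ring.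
by rewrite zln2; lra.
Qed.

End exponent.

(** * Null sets from lower limits of small sets *)

Section liminf.
Local Open Scope classical_set_scope.

(** For fixed n the inner intersections increase with m and lie in [B n m], so continuity from below
    bounds their union by D/(n+1); intersecting over n leaves measure 0. *)
Lemma liminf_negligible d (T : measurableType d) (R : realType)
    (mu : {measure set T -> \bar R}) (B : nat -> nat -> set T) (D : R) :
  (forall n i, measurable (B n i)) ->
  (forall n i, (mu (B n i) <= (D / n.+1%:R)%:E)%E) ->
  mu.-negligible (\bigcap_n \bigcup_m \bigcap_(i in [set i | (m <= i)%N]) B n i).
Proof.
move=> mB BD.
pose E n m := \bigcap_(i in [set i | (m <= i)%N]) B n i.
have mE n m : measurable (E n m) by apply: bigcap_measurableType => i _.
have mUE n : measurable (\bigcup_m E n m) by exact: bigcupT_measurable.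
apply/negligibleP; first exact: bigcapT_measurable.
apply/eqP; rewrite eq_le measure_ge0 andbT.
have ED n : (mu (\bigcup_m E n m) <= (D / n.+1%:R)%:E)%E.
  apply: cvge_to_le (nondecreasing_cvg_mu (mu := mu) (mE n) (mUE n) _) _.
    move=> m m' mm'; apply/subsetPset => x Ex i /= m'i.
    by apply: Ex => /=; exact: leq_trans m'i.
  apply: nearW => m /=; apply: le_trans (BD n m).
  by apply: le_measure; rewrite ?inE//; apply: bigcap_inf => /=.
apply/lee_addgt0Pr => e e0; rewrite add0e.
pose n := Num.truncn (D / e).
apply: (@le_trans _ _ (mu (\bigcup_m E n m))).
  by apply: le_measure; rewrite ?inE//; [exact: bigcapT_measurable|exact: bigcap_inf].
apply: le_trans (ED n) _; rewrite lee_fin ler_pdivrMr ?ltr0n// mulrC -ler_pdivrMr//.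
by rewrite ltW// truncnS_gt.
Qed.

End liminf.

(** * Measure of the bad slopes *)

Section bad_set.
Local Open Scope classical_set_scope.
Context {R : realType}.
Notation mu := (@lebesgue_measure R).

Lemma lebesgue_measure_bigsetU_le (I : Type) (s : seq I) (F : I -> set R) (h : I -> R) :
  (forall i, measurable (F i)) -> (forall i, (mu (F i) <= (h i)%:E)%E) ->
  (mu (\big[setU/set0]_(i <- s) F i) <= (\sum_(i <- s) h i)%:E)%E.
Proof.
move=> mF Fh; elim: s => [|i s IH]; first by rewrite !big_nil measure0.
rewrite !big_cons EFinD; apply: le_trans (measureU2 _ _ _) (leeD (Fh i) IH); first exact: mF.
by apply: bigsetU_measurable => j _; exact: mF.
Qed.

(* For 0 < a <= J, integers v outside [0, J u] have |a u - v| >= 1,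
   hence the range of v; for u = 0 the junk quotient gives an empty interval. *)
Definition bad_slopes (J : nat) (d : R) (X : nat) : set R :=
  \big[setU/set0]_(u <- mul_table X) \big[setU/set0]_(0 <= v < (J * u).+1)
    `](v%:R - d) / u%:R, (v%:R + d) / u%:R[.

Lemma measurable_bad_slopes J d X : measurable (bad_slopes J d X).
Proof. by apply: bigsetU_measurable => u _; apply: bigsetU_measurable => v _; exact: measurable_itv. Qed.

(** Each u >= 1 contributes J u + 1 intervals of length 2d/u, in total at most 2(J + 1)d. *)
Lemma bad_slopes_measure J d X : 0 <= d ->
  (mu (bad_slopes J d X) <= ((size (mul_table X))%:R * (2 * (J%:R + 1) * d))%:E)%E.
Proof.
move=> d0.
have -> : (size (mul_table X))%:R * (2 * (J%:R + 1) * d) = \sum_(u <- mul_table X) (2 * (J%:R + 1) * d).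
  by rewrite -sum1_size natr_sum big_distrl/=; apply: eq_bigr => i _; rewrite mul1r.
apply: lebesgue_measure_bigsetU_le => u.
  by apply: bigsetU_measurable => v _; exact: measurable_itv.
apply: le_trans (lebesgue_measure_bigsetU_le _ _ _ (fun=> 2 * d / u%:R) _ _) _.
- by move=> v; exact: measurable_itv.
- move=> v; rewrite lebesgue_measure_itv/=; case: ifP => _.
    by rewrite -EFinB lee_fin -mulrBl le_eqVlt; apply/orP; left; apply/eqP; congr (_ * _); ring.
  by rewrite lee_fin divr_ge0 ?mulr_ge0.
rewrite lee_fin sumr_const_nat subn0 -(mulr_natr (2 * d / u%:R)).
have [->|u0] := posnP u; first by rewrite invr0 mulr0 mul0r !mulr_ge0// addr_ge0.
have uR : 1 <= u%:R :> R by rewrite ler1n.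
have u0R : 0 < u%:R :> R by lra.
rewrite mulrAC ler_pdivrMr// -(natr1 (J * u)) natrM.
have : 0 <= d * (u%:R - 1) by rewrite mulr_ge0 ?subr_ge0.
lra.
Qed.

Lemma not_bad_slopes J d X (a : R) (u v : nat) : ~ bad_slopes J d X a ->
  u \in mul_table X -> (v <= J * u)%N -> d <= `|a * u%:R - v%:R|.
Proof.
move=> nbad uX vJ; have /mul_tableP[b [b' [/andP[b0 _] /andP[b0' _] uE]]] := uX.
have u0 : 0 < u%:R :> R by rewrite ltr0n uE muln_gt0 b0.
rewrite leNgt; apply/negP; rewrite ltr_distl => /andP[h1 h2]; apply: nbad.
rewrite /bad_slopes -bigcup_seq; exists u => //.
rewrite -bigcup_seq; exists v; first by rewrite /= mem_index_iota.
by rewrite /= in_itv/= ltr_pdivrMr// h1 ltr_pdivlMr.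
Qed.

End bad_set.

(** * Gaps of the sequence for a slope that is not bad *)

Section spectrum.
Context {R : realType}.
Variables (a : R) (l : nat -> R).
Hypotheses (a0 : 0 < a) (irr_a : irrational a) (l_spec : is_lambda_seq a l).

Let lam (m n : nat) : R := a * m%:R ^+ 2 + n%:R ^+ 2.

Lemma lambda_incr i j : (i < j)%N -> l i < l j.
Proof.
elim: j => // j IH; rewrite ltnS leq_eqVlt => /predU1P[->|/IH h]; first exact: l_spec.1.
exact: lt_trans h (l_spec.1 j).
Qed.

Lemma lambda_le i j : (i <= j)%N -> l i <= l j.
Proof. by rewrite leq_eqVlt => /predU1P[->//|/lambda_incr/ltW]. Qed.

Lemma lam_inj m n m' n' : lam m n = lam m' n' -> m = m' /\ n = n'.
Proof.
have irr (u v : nat) (w : int) : a * u%:R = w%:~R + a * v%:R -> u = v.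
  have aux (u' v' : nat) (w' : int) : (v' < u')%N -> a * u'%:R = w'%:~R + a * v'%:R -> False.
    move=> vu h; apply: irr_a; apply/rationalP; exists w', (u' - v')%N.
    have d0 : (u' - v')%:R != 0 :> R by rewrite pnatr_eq0 subn_eq0 -ltnNge.
    by apply: (mulIf d0); rewrite divfK// natrB 1?ltnW// mulrBr h addrK.
  move=> h; case: (ltngtP u v) => // uv; last by case: (aux _ _ _ uv h).
  by case: (aux v u (- w) uv); rewrite h mulrNz addrA addNr add0r.
rewrite /lam -!natrX => h.
have mm : (m ^ 2 = m' ^ 2)%N.
  apply: (irr _ _ ((n' ^ 2)%:Z - (n ^ 2)%:Z)); rewrite intrB -!pmulrn; lra.
have nn : (n ^ 2 = n' ^ 2)%N.
  by move: h; rewrite mm => /addrI /eqP; rewrite eqr_nat => /eqP.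
by split; apply/eqP; rewrite -(eqn_exp2r _ _ (isT : (0 < 2)%N)); apply/eqP.
Qed.

(** Otherwise the M^2 distinct values with m, n <= M, all within the bound, would have to occupy
    only M^2 - 1 indices. *)
Lemma lambda_box_le (M : nat) : (0 < M)%N -> l (M * M).-1 <= (a + 1) * M%:R ^+ 2.
Proof.
move=> M0; rewrite leNgt; apply/negP => big.
have idx (p : 'I_M * 'I_M) : exists i : 'I_(M * M).-1, l i = lam p.1.+1 p.2.+1.
  have [i li] : exists i, l i = lam p.1.+1 p.2.+1.
    by apply/l_spec.2; exists p.1.+1, p.2.+1.
  have iM : (i < (M * M).-1)%N.
    rewrite ltnNge; apply/negP => /lambda_le; apply/negP; rewrite -ltNge.
    apply: le_lt_trans big; rewrite li /lam mulrDl mul1r.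
    have h (q : 'I_M) : q.+1%:R ^+ 2 <= M%:R ^+ 2 :> R.
      by rewrite -!natrX ler_nat leq_exp2r.
    by apply: lerD => //; rewrite ler_pM2l.
  by exists (Ordinal iM).
have [f fE] := choice idx.
have /leq_card : injective f.
  move=> [p1 p2] [q1 q2] /(congr1 (fun i : 'I__ => l i)); rewrite !fE/=.
  by move=> /lam_inj[[p1q1] [p2q2]]; congr pair; apply: val_inj.
rewrite card_prod !card_ord; have : (0 < M * M)%N by rewrite muln_gt0 M0.
by case: (M * M)%N => // q _; rewrite /= ltnn.
Qed.

(** The height bound forces m, m' <= M, so |m - m'| and m + m' are at most 2M <= X and u is in the
    table if m and m' differ. A gap not of the form |a u - v| with v <= J u is at least 1. *)
Lemma gap_ge (J X M i : nat) (d : R) : a <= J%:R -> d <= 1 -> ~ bad_slopes J d X a ->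
  (0 < M)%N -> (2 * M <= X)%N -> l i.+1 <= a * M%:R ^+ 2 -> d <= l i.+1 - l i.
Proof.
move=> aJ d1 nbad M0 MX lM.
have [m [n [m0 [n0 E]]]] := (l_spec.2 (l i.+1)).1 (ex_intro _ i.+1 erefl).
have [m' [n' [m0' [n0' E']]]] := (l_spec.2 (l i)).1 (ex_intro _ i erefl).
have lii := l_spec.1 i.
have coord (p q : nat) (x : R) : x <= l i.+1 -> x = a * p%:R ^+ 2 + q%:R ^+ 2 -> (p <= M)%N.
  move=> xl xE; rewrite -(leq_exp2r _ _ (isT : (0 < 2)%N)) -(ler_nat R) !natrX -(ler_pM2l a0).
  by apply: le_trans lM; apply: le_trans xl; rewrite xE lerDl sqr_ge0.
have mM : (m <= M)%N by apply: coord E.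
have mM' : (m' <= M)%N by apply: coord E'; exact: ltW.
have table p q : (q < p)%N -> (p <= M)%N -> (p ^ 2 - q ^ 2)%N \in mul_table X.
  move=> qp pM; apply/mul_tableP; exists (p - q)%N, (p + q)%N; rewrite subn_sqr; split=> //; lia.
have sqB p q : (q <= p)%N -> (p ^ 2 - q ^ 2)%:R = p%:R ^+ 2 - q%:R ^+ 2 :> R.
  by move=> qp; rewrite natrB ?natrX// leq_exp2r.
have gap1 (x : R) : 0 <= x -> (n' < n)%N -> d <= x + (n%:R ^+ 2 - n'%:R ^+ 2).
  move=> x0 nn; rewrite -(sqB _ _ (ltnW nn)); apply: le_trans d1 _.
  by rewrite ler_wpDl// ler1n subn_gt0 ltn_exp2r.
case: (ltngtP m m') => mm.
- have nn : (n' < n)%N.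
    rewrite ltnNge; apply/negP => nn; move: lii; rewrite E E' ltNge lerD//.
      by rewrite ler_pM2l// -!natrX ler_nat leq_exp2r// ltnW.
    by rewrite -!natrX ler_nat leq_exp2r.
  set u := (m' ^ 2 - m ^ 2)%N; set v := (n ^ 2 - n' ^ 2)%N.
  have gapE : l i.+1 - l i = v%:R - a * u%:R.
    by rewrite (sqB _ _ (ltnW nn)) (sqB _ _ (ltnW mm)) E E'; ring.
  have [vJ|vJ] := leqP v (J * u).
    have := not_bad_slopes _ _ _ _ _ _ nbad (table _ _ mm mM') vJ.
    by rewrite -/u distrC -gapE ger0_norm// subr_ge0 ltW.
  rewrite gapE; apply: le_trans d1 _.
  have : a * u%:R <= J%:R * u%:R by rewrite ler_wpM2r.
  by move: vJ; rewrite -(ler_nat R) -natr1 natrM; lra.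
- set u := (m ^ 2 - m' ^ 2)%N.
  have gapE : l i.+1 - l i = a * u%:R + (n%:R ^+ 2 - n'%:R ^+ 2).
    by rewrite (sqB _ _ (ltnW mm)) E E'; ring.
  have [nn|nn] := ltnP n' n; first by rewrite gapE gap1// mulr_ge0// ltW.
  set v := (n' ^ 2 - n ^ 2)%N.
  have {}gapE : l i.+1 - l i = a * u%:R - v%:R by rewrite gapE (sqB _ _ nn); ring.
  have vJ : (v <= J * u)%N.
    rewrite -(ler_nat R) natrM; have : a * u%:R <= J%:R * u%:R by rewrite ler_wpM2r.
    by move: lii; rewrite -subr_gt0 gapE; lra.
  have := not_bad_slopes _ _ _ _ _ _ nbad (table _ _ mm mM) vJ.
  by rewrite -/u -gapE ger0_norm// subr_ge0 ltW.
- have nn : (n' < n)%N.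
    rewrite ltnNge; apply/negP => nn; move: lii; rewrite E E' mm ltNge lerD2l.
    by rewrite -!natrX ler_nat leq_exp2r// nn.
  have -> : l i.+1 - l i = 0 + (n%:R ^+ 2 - n'%:R ^+ 2) by rewrite E E' mm; ring.
  by rewrite gap1.
Qed.

End spectrum.

(** * Choice of scales and conclusion *)

Lemma delta_min_ge {R : realType} (l : nat -> R) (N : nat) (d : R) : (2 <= N)%N ->
  (forall i, (i.+1 < N)%N -> d <= l i.+1 - l i) -> d <= delta_min l N.
Proof.
move=> N2 H; apply: le_bigmin => [|i _]; first exact: H.
by apply: H; have := ltn_ord i; lia.
Qed.

(** With X = 2^k this is (log X)^c X^(-2) up to a constant factor. *)
Definition gap_scale {R : realType} (k : nat) : R := expR (c_exp * ln k%:R) / 4 ^+ k.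

Lemma gap_scale_gt0 {R : realType} k : 0 < gap_scale k :> R.
Proof. by rewrite divr_gt0 ?expR_gt0// exprn_gt0. Qed.

Lemma gap_scale_le1 {R : realType} k : (0 < k)%N -> gap_scale k <= 1 :> R.
Proof.
move=> k0; rewrite ler_pdivrMr ?exprn_gt0// mul1r.
apply: (@le_trans _ _ k%:R).
  rewrite -[leRHS]lnK ?posrE ?ltr0n// ler_expR ler_piMl ?ln_natr_ge0//.
  exact: c_exp_le1.
by rewrite -natrX ler_nat ltnW// ltn_expl.
Qed.

(** For N = 4^k / 4^(j+1), the bound ln N <= 2k costs 2^c and the denominator costs 4^(j+1). *)
Lemma log_power_le_gap_scale {R : realType} (j k : nat) : (j.+1 < k)%N ->
  (4 ^+ j.+1 * expR (c_exp * ln 2))^-1 *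
    (powR (ln (4 ^ (k - j.+1))%:R) c_exp / (4 ^ (k - j.+1))%:R) <= gap_scale k :> R.
Proof.
move=> jk; set N := (4 ^ _)%N.
have N1 : (1 < N)%N by rewrite -[1%N](expn0 4) ltn_exp2l// subn_gt0.
have lnN0 : 0 < ln N%:R :> R by rewrite ln_gt0// ltr1n.
have k0 : 0 < k%:R :> R by rewrite ltr0n (leq_trans _ jk).
have NE : N%:R = 4 ^+ k / 4 ^+ j.+1 :> R.
  by rewrite /N natrX -expfB// ltnW.
have lnNk : ln N%:R <= k%:R * 2 :> R.
  rewrite /N natrX lnXn// -(mulr_natl (ln 4)).
  apply: ler_pM => //; rewrite ?ler_nat ?leq_subr ?ln_natr_ge0//.
  rewrite [4](_ : _ = 2 * 2) ?lnM ?posrE//; last by rewrite -natrM.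
  by have := @ln2_lt1 R; lra.
have e2 := expR_gt0 (c_exp * ln 2 : R).
set x := powR _ _; rewrite NE /gap_scale; set q : R := 4 ^+ k; set p : R := 4 ^+ j.+1.
have q0 : 0 < q by rewrite exprn_gt0.
have p0 : 0 < p by rewrite exprn_gt0.
rewrite [leLHS](_ : _ = x / expR (c_exp * ln 2) / q); last by field; rewrite !gt_eqF.
rewrite ler_wpM2r ?invr_ge0 ?(ltW q0)// /x.
rewrite ler_pdivrMr// -expRD /powR gt_eqF// ler_expR -mulrDr.
apply: ler_wpM2l; first exact: c_exp_ge0.
by rewrite -lnM ?posrE// ler_ln ?posrE// mulr_gt0.
Qed.

Theorem theorem1p3 (R : realType) :
  {ae (@lebesgue_measure R), forall a : R, 0 < a -> @irrational R a ->
     forall l : nat -> R, is_lambda_seq a l ->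
       exists C : R, 0 < C /\
         forall K : nat, exists N : nat, (K <= N)%N /\ (2 <= N)%N /\
           C * (powR (ln (N%:R)) c_exp / N%:R) <= delta_min l N}.
Proof.
have [C C0 Hsparse] := @mul_table_sparse R.
have [kap kapP] := choice Hsparse.
pose d n i : R := n.+1%:R^-1 * gap_scale (kap i).
pose B j n i : set R := bad_slopes (4 ^ j) (d n i) (2 ^ kap i).
have d0 n i : 0 < d n i by rewrite mulr_gt0 ?invr_gt0 ?gap_scale_gt0.
(* Exceptional slopes: for some j, with J = 4^j and every eps = 1/(n+1), they are bad at all large
   i. *)
have negl : (@lebesgue_measure R).-negligible
    (\bigcup_j \bigcap_n \bigcup_m \bigcap_(i in [set i | (m <= i)%N]) B j n i)%classic.
  apply: negligible_bigcup => j.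
  apply: (@liminf_negligible _ _ _ _ _ (2 * ((4 ^ j)%:R + 1) * C)) => n i.
    exact: measurable_bad_slopes.
  apply: le_trans (bad_slopes_measure _ _ _ (ltW (d0 n i))) _; rewrite lee_fin.
  have [_ _ Hsz] := kapP i.
  have J0 : 0 <= 2 * ((4 ^ j)%:R + 1) * d n i :> R by rewrite !mulr_ge0 ?addr_ge0// ltW.
  apply: le_trans (ler_wpM2r J0 Hsz) _; rewrite /d /gap_scale.
  rewrite mulNr expRN le_eqVlt; apply/orP; left; apply/eqP; field.
  by rewrite expf_neq0//= !gt_eqF// expR_gt0.
apply: negligibleS negl => a /= nP.
apply: contrapT => Hnot; apply: nP => a0 irr_a l l_spec.
(* One j gives both a <= 4^j, for [gap_ge], and a + 1 <= 4^j a, where the summand 1/a enters. *)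
pose j := (Num.truncn (a + a^-1 + 1)).+1.
have j4 : a + a^-1 + 1 <= (4 ^ j)%:R.
  apply: ltW; apply: lt_le_trans (truncnS_gt _) _.
  by rewrite ler_nat ltnW// ltn_expl.
have ai0 : 0 < a^-1 by rewrite invr_gt0.
have /existsNP[n Hn] : ~ forall n, (\bigcup_m \bigcap_(i in [set i | (m <= i)%N]) B j n i)%classic a.
  by move=> H; apply: Hnot; exists j => // n _.
have often m : exists2 i, (m <= i)%N & ~ B j n i a.
  apply: contrapT => H; apply: Hn; exists m => // i /= mi.
  by apply: contrapT => Hi; apply: H; exists i.
exists (n.+1%:R^-1 * (4 ^+ j.+1 * expR (c_exp * ln 2))^-1); split.
  by rewrite mulr_gt0 ?invr_gt0// mulr_gt0 ?expR_gt0// exprn_gt0.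
(* Since k >= i >= K + j + 2, the exponent k - j - 1 is positive and at least K. *)
move=> K; have [i mi nbad] := often (K + j.+2)%N.
have [ik k0 _] := kapP i; set k := kap i in ik k0.
have jk : (j.+1 < k)%N by lia.
have Kk : (K <= k - j.+1)%N by lia.
pose N := (4 ^ (k - j.+1))%N; exists N.
have N2 : (2 <= N)%N by rewrite -[1%N](expn0 4) ltn_exp2l// subn_gt0.
split; first by apply: (leq_trans Kk); rewrite ltnW// ltn_expl.
split => //; rewrite -mulrA.
apply: (@le_trans _ _ (d n i)).
  by rewrite ler_pM2l ?invr_gt0//; exact: log_power_le_gap_scale.
have dle1 : d n i <= 1.
  rewrite -[leRHS]mulr1; apply: ler_pM; rewrite ?invr_ge0 ?(ltW (gap_scale_gt0 _))//.
    by rewrite invf_le1// ler1n.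
  exact: gap_scale_le1.
pose M := (2 ^ (k - j.+1))%N.
have M0 : (0 < M)%N by rewrite expn_gt0.
have NE : N = (M * M)%N by rewrite /N /M -expnMn.
apply: delta_min_ge => // i' i'N.
(* The first N = M^2 values are at most (a + 1) M^2 <= a (2^j M)^2, so m <= 2^j M there, and twice
   that is the table side 2^k. *)
apply: (@gap_ge R a l a0 l_spec (4 ^ j) (2 ^ k) (2 ^ j * M) i') => //.
- by apply: le_trans j4; lra.
- by rewrite muln_gt0 expn_gt0.
- by rewrite /M mulnA -expnS -expnD subnKC// ltnW.
apply: le_trans (lambda_le _ _ l_spec _ (M * M).-1 _) _; first by rewrite -NE; lia.
apply: le_trans (lambda_box_le _ _ a0 irr_a l_spec M M0) _.
rewrite natrM exprMn [leRHS]mulrA ler_wpM2r ?sqr_ge0//.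
rewrite -natrX -expnM mulnC expnM.
have : a * (a + a^-1 + 1) <= a * (4 ^ j)%:R by rewrite ler_pM2l.
rewrite !mulrDr mulfV ?gt_eqF// mulr1; have := sqr_ge0 a; rewrite expr2; lra.
Qed.
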